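(* For any real numbers $\theta>0$, $\epsilon\in(0,1)$ and $q\geq 1$, there exists $c>0$ depending only on $\theta,\epsilon,q$ such that the following holds. For any positive integer $r\leq \frac{c\log n}{\log\log n}$, if the number of items satisfies $m\in[rn+n^\epsilon,(r+1)n-n^\epsilon]$ and the utilities $u_i(j)$ ($i\in[n]$, $j\in[m]$) are drawn independently from a distribution $\mathcal{U}$ on $[0,1]$ that is $(\theta,q)$-polynomially bounded below at 1, then with high probability there is no envy-free allocation of the $m$ items among the $n$ agents.
   Context: There is a set $N=[n]$ of agents and a set $M=[m]$ of indivisible items. Agent $i$ has utility $u_i(j)\in[0,1]$ for item $j$, and utilities are additive: $u_i(M')=\sum_{j\in M'}u_i(j)$. An allocation is a partition $(M_1,\dots,M_n)$ of $M$, with $M_i$ given to agent $i$; it is envy-free if $u_i(M_i)\geq u_i(M_{i'})$ for all $i,i'\in N$. A distribution $\mathcal{U}$ on $[0,1]$ is $(\theta,q)$-polynomially bounded below at 1 if for every $\alpha\in(0,1]$, $\Pr_{u\sim\mathcal{U}}[u>1-\alpha]\geq\theta\alpha^q$. ''With high probability'' means with probability tending to 1 as $n\to\infty$; $\log$ is the natural logarithm. *)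

(* Defs.v *)
From HB Require Import structures.
From mathcomp Require Import all_boot all_order all_algebra.
From mathcomp Require Import all_classical all_reals all_analysis.
Set Implicit Arguments. Unset Strict Implicit. Unset Printing Implicit Defensive.
Import Order.TTheory GRing.Theory Num.Theory.
Local Open Scope classical_set_scope.
Local Open Scope ring_scope.

(* Allocation of items 'I_m to agents 'I_n : item j goes to agent A j
   (equivalently, the partition (M_1,...,M_n) with M_i = A^-1(i)). *)
Definition bundle_value (R : realType) (n m : nat) (u : 'I_n -> 'I_m -> R)
  (A : 'I_m -> 'I_n) (i k : 'I_n) : R :=
  \sum_(j < m | A j == k) u i j.

Definition envy_free (R : realType) (n m : nat) (u : 'I_n -> 'I_m -> R)
  (A : 'I_m -> 'I_n) : Prop :=
  forall i i' : 'I_n, bundle_value u A i i' <= bundle_value u A i i.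

Definition has_envy_free_allocation (R : realType) (n m : nat)
  (u : 'I_n -> 'I_m -> R) : Prop :=
  exists A : 'I_m -> 'I_n, envy_free u A.

Definition supported_on_unit (R : realType) (U : probability R R) : Prop :=
  U `[0%R, 1%R]%classic = 1%E.

Definition poly_bounded_below_at_1 (R : realType) (U : probability R R)
  (theta q : R) : Prop :=
  forall alpha : R, 0 < alpha -> alpha <= 1 ->
    ((theta * powR alpha q)%:E <= U `](1 - alpha)%R, +oo[%classic)%E.

Definition iid_utilities (R : realType) (n m : nat) d (T : measurableType d)
  (P : probability T R) (X : 'I_n -> 'I_m -> {RV P >-> R})
  (U : probability R R) : Prop :=
  (forall (i : 'I_n) (j : 'I_m) (B : set R), measurable B ->
      P (X i j @^-1` B) = U B) /\
  (forall B : 'I_n * 'I_m -> set R, (forall k, measurable (B k)) ->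
      P [set w | forall k : 'I_n * 'I_m, B k (X k.1 k.2 w)] =
      (\big[*%E/1%E]_(k : 'I_n * 'I_m) P (X k.1 k.2 @^-1` B k))%E).

(* Main.v *)
(* In an envy-free allocation an agent i holding at most r items has value at
   most r, so u_i(B) <= r for every (r+1)-subset B of a bundle; hence some item
   of B has utility at most 1 - 1/(r+1) for i.  As m <= (r+1)n - n^eps there are
   s such agents, and as m >= rn + n^eps one can cut s disjoint (r+1)-sets out
   of the bundles, for s = floor(n^(eps/2)).  For fixed agents and fixed sets
   the s^2 events concern disjoint families of utilities, so they all hold with
   probability (1 - p^(r+1))^(s^2) where p = U(]1 - 1/(r+1), +oo[), and the
   bound on r gives p^(r+1) >= n^(-eps/4).  The number of choices of s agents
   and s sets is only n^s m^((r+1)s) = exp(O(s log^2 n)), so a union bound over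
   these choices, rather than over all allocations, suffices. *)
Require Import Defs.
From mathcomp Require Import all_boot all_order all_algebra.
From mathcomp Require Import all_classical all_reals all_analysis.
From mathcomp Require Import ring lra zify.
Set Implicit Arguments.
Unset Strict Implicit.
Unset Printing Implicit Defensive.
Import Order.TTheory GRing.Theory Num.Theory.

(** * Counting in finite sets: small bundles and disjoint blocks *)

Lemma exists_subset_card (T : finType) (A : {set T}) n :
  n <= #|A| -> exists2 B : {set T}, B \subset A & #|B| = n.
Proof.
move=> /card_geqP[s [us <- sA]]; exists [set x in s].
  by apply/fintype.subsetP => x; rewrite inE => /sA.
by rewrite cardsE; apply/card_uniqP.
Qed.

Lemma sum_card_fiber (I K : finType) (A : K -> I) (X : {set K}) :
  \sum_i #|[set j in X | A j == i]| = #|X|.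
Proof.
rewrite -sum1_card (partition_big A xpredT) //=.
by apply: eq_bigr => i _; rewrite -sum1_card; apply: eq_bigl => j; rewrite inE.
Qed.

(** Each index outside [S0] has at least [r.+1] points in its fiber, and fibers are disjoint, so
    [#|K|] is at least [r.+1] times the number of such indices. This leaves at least [s] indices in
    [S0]. *)
Lemma exists_small_fibers (I K : finType) (A : K -> I) (r s : nat) :
  s * r.+1 + #|K| <= r.+1 * #|I| ->
  exists2 S : {set I}, #|S| = s &
    forall i, i \in S -> #|[set j | A j == i]| <= r.
Proof.
move=> h; pose S0 := [set i | #|[set j | A j == i]| <= r].
have : s <= #|S0|.
  rewrite -(leq_pmul2r (ltn0Sn r)) -(leq_add2r #|K|) (leq_trans h) //.
  rewrite -(cardsC S0) mulnDr [r.+1 * #|S0|]mulnC leq_add2l.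
  rewrite -cardsT -(sum_card_fiber A) mulnC.
  rewrite -sum_nat_const [leqRHS](bigID (mem S0)) /=.
  apply: leq_trans (leq_addl _ _).
  rewrite (eq_bigl (fun i => i \notin S0)) => [|i]; last by rewrite inE.
  apply: leq_sum => i; rewrite !inE -ltnNge => /leq_trans; apply.
  by apply/subset_leq_card/fintype.subsetP => j; rewrite !inE.
move=> /exists_subset_card[S /fintype.subsetP sS cS]; exists S => // i /sS.
by rewrite inE.
Qed.

(** Blocks are cut greedily: while fewer than [t] have been cut, more than [r * #|I|] points remain
    uncovered, so by pigeonhole some fiber still has [r.+1] uncovered points. *)
Lemma exists_disjoint_blocks (I K : finType) (A : K -> I) (r t : nat) :
  t * r.+1 + r * #|I| <= #|K| ->
  exists D : {set {set K}}, [/\ #|D| = t, finset.trivIset D,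
    (forall B, B \in D -> #|B| = r.+1) &
    (forall B, B \in D -> exists i, forall j, j \in B -> A j = i)].
Proof.
elim: t => [_|t IH h].
  exists finset.set0; rewrite cards0; split=> // [|B|B]; rewrite ?inE //.
  by apply/finset.trivIsetP => ? ?; rewrite inE.
have [|D [cD tD sD mD]] := IH; first by lia.
have cC : #|~: finset.cover D| > r * #|I|.
  have : #|finset.cover D| = t * r.+1.
    move: tD; rewrite /finset.trivIset => /eqP <-.
    by rewrite (eq_bigr (fun=> r.+1)) ?sum_nat_const ?cD.
  have := cardsC (finset.cover D); rewrite mulSn in h; lia.
have [i ri] : exists i, r < #|[set j in ~: finset.cover D | A j == i]|.
  apply/existsP; apply: contraLR cC => /existsPn Hn; rewrite -leqNgt.
  rewrite -(sum_card_fiber A) mulnC -sum_nat_const.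
  by apply: leq_sum => i _; rewrite leqNgt.
have [B /fintype.subsetP sB cB] := exists_subset_card ri.
have dB B' : B' \in D -> [disjoint B & B'].
  move=> B'D; apply/pred0P => j /=; apply/negbTE/negP => /andP[/sB].
  rewrite !inE => /andP[+ _] jB'; apply/negP; rewrite negbK.
  by apply/finset.bigcupP; exists B'.
have [|tU nB] := trivIsetU1 dB tD.
  by apply/negP => /sD; rewrite cards0.
exists (B |: D); split=> //; first by rewrite cardsU1 nB cD.
  by move=> B'; rewrite !inE => /orP[/eqP-> //|/sD].
move=> B'; rewrite !inE => /orP[/eqP-> |/mD//].
by exists i => j /sB; rewrite !inE => /andP[_ /eqP].
Qed.

Lemma leq_bin_exp n k : 'C(n, k) <= n ^ k.
Proof.
apply: (@leq_trans (n ^_ k)); first by rewrite -bin_ffact leq_pmulr ?fact_gt0.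
elim: k n => [|k IH] n //; rewrite ffactnSr expnS mulnC.
by rewrite leq_mul ?leq_subr.
Qed.

Local Open Scope classical_set_scope.
Local Open Scope ring_scope.

(** * Events over a finite index set: measurability, disjoint blocks, subadditivity *)

Lemma measurable_forall_in d (T : measurableType d) (K : finType)
    (E : K -> set T) (H : {set K}) :
  (forall k, measurable (E k)) ->
  measurable [set w | forall k, k \in H -> E k w].
Proof.
move=> mE.
have -> : [set w | forall k, k \in H -> E k w] =
          \bigcap_(k in [set` H]) E k by [].
by apply: fin_bigcap_measurable => // k _; exact: mE.
Qed.

Lemma measurable_exists_notin d (T : measurableType d) (K : finType)
    (E : K -> set T) (J : choiceType) (G : J -> {set K}) (s : seq J) :
  (forall k, measurable (E k)) ->
  measurable [set w | forall x, x \in s -> exists2 k, k \in G x & ~ E k w].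
Proof.
move=> mE.
have -> : [set w | forall x, x \in s -> exists2 k, k \in G x & ~ E k w] =
    \bigcap_(x in [set` s]) ~` [set w | forall k, k \in G x -> E k w].
  apply/seteqP; split => w /= Hw x /Hw; first by case=> k kG nE /(_ k kG).
  by move=> /existsNP[k /not_implyP[kG nE]]; exists k.
apply: fin_bigcap_measurable => [|x _]; first exact: finite_seq.
exact/measurableC/measurable_forall_in.
Qed.

Lemma probability_no_full_block d (T : measurableType d) (R : realType)
    (P : probability T R) (K : finType) (E : K -> set T) (p : R) (a : nat)
    (J : choiceType) (G : J -> {set K}) (s : seq J) (F : {set K}) :
  (forall k, measurable (E k)) ->
  (forall H : {set K},
     P [set w | forall k, k \in H -> E k w] = (p ^+ #|H|)%:E) ->
  uniq s -> {in s, forall x, #|G x| = a} ->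
  {in s &, forall x y, x != y -> [disjoint G x & G y]%B} ->
  {in s, forall x, [disjoint F & G x]%B} ->
  P ([set w | forall k, k \in F -> E k w] `&`
     [set w | forall x, x \in s -> exists2 k, k \in G x & ~ E k w]) =
  (p ^+ #|F| * (1 - p ^+ a) ^+ size s)%:E.
Proof.
move=> mE PE; elim: s F => [|x s IH] F.
  move=> _ _ _ _; rewrite mulr1 -PE; congr (P _).
  by apply/seteqP; split=> w /= => [[]//|Hw]; split.
move=> /= /andP[xs us] ca dG dF.
set A := [set w | forall k, k \in F -> E k w].
set C := [set w | forall k, k \in G x -> E k w].
set V := [set w | forall x, x \in s -> exists2 k, k \in G x & ~ E k w].
have ss y : y \in s -> y \in x :: s by move=> ys; rewrite inE ys orbT.
have mA : measurable (A `&` V).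
  apply: measurableI; first exact: measurable_forall_in.
  exact: measurable_exists_notin.
have mC : measurable C by exact: measurable_forall_in.
have -> : A `&` [set w | forall y, y \in x :: s ->
     exists2 k, k \in G y & ~ E k w] = (A `&` V) `\` C.
  apply/seteqP; split => w /=.
    move=> [Aw Hw]; split; first by split=> // y ys; exact/Hw/ss.
    by have [k kG nE] := Hw x (mem_head _ _); move=> /(_ k kG).
  move=> [[Aw Vw] /existsNP[k /not_implyP[kG nE]]]; split=> // y.
  by rewrite inE => /orP[/eqP->|/Vw //]; exists k.
(* Induction on s: avoiding G x amounts to removing the event that E holds on
   F :|: G x, which has the same shape with a larger F. *)
have -> : P ((A `&` V) `\` C) = (P (A `&` V) - P (A `&` V `&` C))%E.
  by apply: measureD; rewrite ?(le_lt_trans (probability_le1 P mA)) ?ltry.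
have PV (H : {set K}) : {in s, forall y, [disjoint H & G y]%B} ->
    P ([set w | forall k, k \in H -> E k w] `&` V) =
    (p ^+ #|H| * (1 - p ^+ a) ^+ size s)%:E.
  move=> dH; apply: IH => // [y /ss|y z /ss ys /ss zs]; first exact: ca.
  exact: dG.
rewrite /A PV; last by move=> y /ss; exact: dF.
have -> : [set w | forall k, k \in F -> E k w] `&` V `&` C = [set w | forall k, k \in F :|: G x -> E k w] `&` V.
  apply/seteqP; split => w /=.
    by move=> [[Aw Vw] Cw]; split=> // k; rewrite inE => /orP[/Aw|/Cw].
  move=> [AC Vw]; split; first split=> //.
    by move=> k kF; apply: AC; rewrite inE kF.
  by move=> k kF; apply: AC; rewrite inE kF orbT.
rewrite PV; last first.
  move=> y ys; rewrite finset.disjoints_subset finset.subUset -!finset.disjoints_subset.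
  rewrite dF ?ss //= dG ?mem_head ?ss //.
  by apply: contraNneq xs => ->.
have -> : #|F :|: G x| = (#|F| + a)%N.
  have := dF x (mem_head _ _).
  by rewrite -leq_card_setU cardsU => /eqP->; rewrite ca ?mem_head.
by rewrite -EFinB exprD exprS; congr (_%:E); ring.
Qed.

Lemma measure_bigsetU_le d (T : measurableType d) (R : realType)
    (mu : {measure set T -> \bar R}) (I : Type) (s : seq I) (Q : pred I)
    (A : I -> set T) :
  (forall i, measurable (A i)) ->
  (mu (\big[setU/set0]_(i <- s | Q i) A i) <= \sum_(i <- s | Q i) mu (A i))%E.
Proof.
move=> mA; elim: s => [|i s IH]; first by rewrite !big_nil measure0.
rewrite !big_cons; case: (Q i) => //.
rewrite (le_trans (measureU2 mu _ _)) ?leeD2l //.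
exact: bigsetU_measurable.
Qed.

(** * From envy-freeness to a union bound over agents and blocks *)

Lemma measurable_has_envy_free_allocation d (T : measurableType d)
    (R : realType) (P : probability T R) n m
    (X : 'I_n -> 'I_m -> {RV P >-> R}) :
  measurable [set w | has_envy_free_allocation (fun i j => X i j w)].
Proof.
(* Replacing functions by the finite type [{ffun 'I_m -> 'I_n}] makes the union over allocations
   finite. *)
have -> : [set w | has_envy_free_allocation (fun i j => X i j w)] =
  \bigcup_(A in [set: {ffun 'I_m -> 'I_n}]) \bigcap_(k in [set: 'I_n * 'I_n])
    [set w | bundle_value (fun i j => X i j w) A k.1 k.2
             <= bundle_value (fun i j => X i j w) A k.1 k.1].
  apply/seteqP; split => w /=.
    move=> [A envyA]; exists (finfun A) => // -[i k] _ /=.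
    have := envyA i k; congr (_ <= _); apply: eq_bigl => j; by rewrite ffunE.
  by move=> [A _ envyA]; exists A => i k; exact: (envyA (i, k)).
apply: fin_bigcup_measurable => // A _.
apply: fin_bigcap_measurable => // k _.
have mb i l : measurable_fun [set: T]
    (fun w => bundle_value (fun i j => X i j w) A i l).
  rewrite /bundle_value; under eq_fun do rewrite -big_filter.
  by apply: measurable_sum => j; exact: measurable_funPT.
by rewrite -[X in measurable X]setTI; apply: measurable_fun_le.
Qed.

Lemma envy_free_low_blocks (R : realType) n m (u : 'I_n -> 'I_m -> R)
    (A : 'I_m -> 'I_n) (r s : nat) :
  (forall i j, 0 <= u i j <= 1) -> envy_free u A ->
  (s * r.+1 + m <= r.+1 * n)%N -> (s * r.+1 + r * n <= m)%N ->
  exists S : {set 'I_n}, exists D : {set {set 'I_m}},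
    [/\ #|S| = s, #|D| = s, finset.trivIset D,
        forall B, B \in D -> #|B| = r.+1 &
        forall i B, i \in S -> B \in D ->
          exists2 j, j \in B & u i j <= 1 - r.+1%:R^-1].
Proof.
move=> u01 efA hS hD.
have [|S cS smallS] := @exists_small_fibers _ _ A r s.
  by rewrite !card_ord.
have [|D [cD tD sD mD]] := @exists_disjoint_blocks _ _ A r s.
  by rewrite !card_ord.
exists S, D; split=> // i B iS BD; have [k Bk] := mD _ BD.
(* Otherwise the [r.+1] items of [B] are each worth more than 1 - 1/(r+1) to [i], so [B] is worth
   more than r; but [B] lies in the bundle of [k], which [i] values at most as much as its own,
   hence at most r. *)
apply: contrapT => noj.
have own : bundle_value u A i i <= r%:R.
  apply: (@le_trans _ _ #|[set j | A j == i]%SET|%:R).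
    rewrite -sum1_card natr_sum /bundle_value.
    rewrite [leRHS](eq_bigl (fun j => A j == i)) => [|j]; last by rewrite inE.
    by apply: ler_sum => j _; case/andP: (u01 i j).
  by rewrite ler_nat smallS.
have other : \sum_(j in B) u i j <= bundle_value u A i k.
  rewrite /bundle_value [leRHS](bigID (mem B)) /=.
  rewrite (eq_bigl (fun j => (A j == k) && (j \in B))) => [|j].
    by rewrite lerDl sumr_ge0 // => j _; case/andP: (u01 i j).
  by case: (boolP (j \in B)) => [/Bk->|]; rewrite ?eqxx ?andbF.
suff : r%:R < \sum_(j in B) u i j.
  by rewrite ltNge (le_trans other) // (le_trans (efA i k)).
have -> : r%:R = \sum_(j in B) (1 - r.+1%:R^-1) :> R.
  rewrite sumr_const sD // -[RHS]mulr_natr mulrBl mulVf ?mul1r ?pnatr_eq0 //.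
  by rewrite -natr1 addrK.
apply: ltr_sum => [|j jB].
  have : (0 < #|B|)%N by rewrite sD.
  by case/card_gt0P => j jB; apply/hasP; exists j => //; rewrite mem_index_enum.
by rewrite ltNge; apply/negP => ?; apply: noj; exists j.
Qed.

Lemma iid_utilities_all_in (R : realType) n m d (T : measurableType d)
    (P : probability T R) (X : 'I_n -> 'I_m -> {RV P >-> R})
    (U : probability R R) (I : set R) (H : {set 'I_n * 'I_m}) :
  iid_utilities X U -> measurable I ->
  P [set w | forall k, k \in H -> (X k.1 k.2 @^-1` I) w] =
  (fine (U I) ^+ #|H|)%:E.
Proof.
(* The product formula runs over all pairs; taking the whole line outside [H] turns the other
   factors into 1. *)
move=> [XU indX] mI; pose B k := if k \in H then I else setT.
have -> : [set w | forall k, k \in H -> (X k.1 k.2 @^-1` I) w] =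
    [set w | forall k : 'I_n * 'I_m, B k (X k.1 k.2 w)].
  apply/seteqP; split => w /= Hw k; rewrite /B; last first.
    by move=> kH; have := Hw k; rewrite /B kH.
  by case: ifP => // /Hw.
rewrite indX => [|k]; last by rewrite /B; case: ifP.
rewrite (eq_bigr (fun k => (if k \in H then fine (U I) else 1)%:E)) => [|k _].
  by rewrite prodEFin -big_mkcond prodr_const.
rewrite XU; last by rewrite /B; case: ifP.
rewrite /B; case: ifP => _; last exact: probability_setT.
by rewrite fineK ?fin_num_measure.
Qed.

Lemma probability_envy_free_le (R : realType) n m d (T : measurableType d)
    (P : probability T R) (X : 'I_n -> 'I_m -> {RV P >-> R})
    (U : probability R R) (r s : nat) (p := fine (U `](1 - r.+1%:R^-1)%R, +oo[%classic)) :
  iid_utilities X U -> supported_on_unit U ->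
  (s * r.+1 + m <= r.+1 * n)%N -> (s * r.+1 + r * n <= m)%N ->
  (P [set w | has_envy_free_allocation (fun i j => X i j w)] <=
   ((n ^ s * (m ^ r.+1) ^ s)%:R * (1 - p ^+ r.+1) ^+ (s * s))%:E)%E.
Proof.
move=> iidX U1 hS hD.
set I : set R := `](1 - r.+1%:R^-1), +oo[%classic.
have mI : measurable I by exact: measurable_itv.
pose E (k : 'I_n * 'I_m) := X k.1 k.2 @^-1` I.
have mX i j (B : set R) : measurable B -> measurable (X i j @^-1` B).
  by move=> mB; rewrite -[X in measurable X]setTI; exact: measurable_funPT.
have mE k : measurable (E k) by exact: mX.
have PE (H : {set 'I_n * 'I_m}) :
    P [set w | forall k, k \in H -> E k w] = (p ^+ #|H|)%:E.
  exact: iid_utilities_all_in.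
(* [block (i, B)] collects the utilities of agent [i] for the items of [B]; [bad (S, D)] says that
   each such block has a utility of at most 1 - 1/(r+1). *)
pose block (x : 'I_n * {set 'I_m}) := finset.setX [set x.1]%SET x.2.
pose candidates : {set {set 'I_n} * {set {set 'I_m}}} :=
  [set y : {set 'I_n} * {set {set 'I_m}} |
     [&& #|y.1| == s, #|y.2| == s, finset.trivIset y.2 &
           [forall B in y.2, #|B| == r.+1]]]%SET.
pose bad (y : {set 'I_n} * {set {set 'I_m}}) :=
  [set w | forall x, x \in enum (finset.setX y.1 y.2) ->
     exists2 k, k \in block x & ~ E k w].
(* Utilities lie in [0,1] only almost surely, so the null events [off k] join the union bound. *)
pose off (k : 'I_n * 'I_m) := X k.1 k.2 @^-1` (~` `[0, 1]%classic).
have moff k : measurable (off k).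
  by apply: mX; apply: measurableC; exact: measurable_itv.
have Poff k : P (off k) = 0%E.
  rewrite /off iidX.1; last by apply: measurableC; exact: measurable_itv.
  by rewrite probability_setC ?U1 ?subee //; exact: measurable_itv.
have mbad y : measurable (bad y) by exact: measurable_exists_notin.
have Pbad y : y \in candidates -> P (bad y) = ((1 - p ^+ r.+1) ^+ (s * s))%:E.
  rewrite inE => /and4P[/eqP c1 /eqP c2 /finset.trivIsetP tD /forallP sD].
  have szy x : x \in enum (finset.setX y.1 y.2) ->
      [/\ x.1 \in y.1, x.2 \in y.2 & #|x.2| = r.+1].
    rewrite mem_enum inE => /andP[x1 x2]; split=> //.
    by apply/eqP; exact: (implyP (sD x.2)).
  have := @probability_no_full_block _ _ _ P _ E p r.+1 _ block
    (enum (finset.setX y.1 y.2)) finset.set0 mE PE (enum_uniq _).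
  rewrite cards0 expr0 mul1r -cardE cardsX c1 c2.
  move=> <-.
  - congr (P _); apply/seteqP; split => w /=; last by case.
    by move=> bw; split=> // k; rewrite inE.
  - by move=> x /szy[_ _ cx]; rewrite cardsX cards1 mul1n.
  (* Blocks of distinct agents differ in the first coordinate; for a common agent, the two item sets
     are distinct members of [y.2], hence disjoint. *)
  - move=> x z /szy[x1 x2 _] /szy[z1 z2 _] xz.
    apply/pred0P => -[i j] /=; rewrite !inE /=; apply/negbTE/negP.
    move=> /andP[/andP[/eqP -> jx] /andP[/eqP e jz]].
    have x2z2 : x.2 != z.2.
      by apply: contraNneq xz => e2; apply/eqP/injective_projections.
    by have /pred0P/(_ j) := tD _ _ x2 z2 x2z2; rewrite /= jx jz.
  - by move=> x _; apply/pred0P => k /=; rewrite inE.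
(* Dropping the disjointness of the sets leaves a choice of [s] agents and of [s] among the
   [r.+1]-subsets, each binomial being bounded by a power. *)
have cardC : (#|candidates| <= n ^ s * (m ^ r.+1) ^ s)%N.
  pose blocks : {set {set 'I_m}} := [set B : {set 'I_m} | #|B| == r.+1]%SET.
  apply: (@leq_trans #|finset.setX [set S : {set 'I_n} | #|S| == s]%SET
      [set D : {set {set 'I_m}} | D \subset blocks & #|D| == s]%SET|).
    apply/subset_leq_card/fintype.subsetP => y; rewrite !inE.
    move=> /and4P[-> -> _ /forallP sD]; rewrite andbT /=.
    by apply/fintype.subsetP => B BD; rewrite inE (implyP (sD B)).
  rewrite cardsX card_draws cards_draws card_draws !card_ord.
  rewrite leq_mul ?leq_bin_exp //.
  rewrite (leq_trans (leq_bin_exp _ _)) //.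
  by case: (posnP s) => [->|s_gt0]; rewrite ?expn0 ?leq_exp2r ?leq_bin_exp.
apply: (@le_trans _ _ (P ((\big[setU/set0]_k off k) `|`
                         (\big[setU/set0]_(y in candidates) bad y)))).
  apply: le_measure; rewrite ?inE.
  - exact: measurable_has_envy_free_allocation.
  - by apply: measurableU; exact: bigsetU_measurable.
  move=> w /= [A efA].
  have [[k offk]|on] := pselect (exists k, off k w).
    by left; rewrite (bigD1 k) //=; left.
  have u01 i j : 0 <= X i j w <= 1.
    apply/negPn/negP => nX; apply: on; exists (i, j); rewrite /off /= in_itv /=.
    exact/negP.
  have [S [D [cS cD tD sD lowD]]] := envy_free_low_blocks u01 efA hS hD.
  have SDc : (S, D) \in candidates.
    rewrite inE /= cS cD !eqxx tD /=; apply/forallP => B; apply/implyP => BD.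
    by rewrite sD.
  right; rewrite (bigD1 (S, D)) //=; left => -[i B]; rewrite mem_enum inE /=.
  move=> /andP[iS BD]; have [j jB low] := lowD i B iS BD.
  exists (i, j); first by rewrite !inE /= eqxx.
  by rewrite /E /I /= in_itv /= andbT => /lt_geF; rewrite low.
apply: (le_trans (measureU2 _ _ _)); [exact: bigsetU_measurable..|].
apply: (@le_trans _ _ (0 + \sum_(y in candidates) P (bad y))%E).
  apply: leeD; last exact: measure_bigsetU_le.
  rewrite (le_trans (measure_bigsetU_le P _ _ moff)) // big1 // => k _.
  exact: Poff.
rewrite add0e (eq_bigr _ Pbad) sumEFin lee_fin sumr_const -[leLHS]mulr_natl.
rewrite ler_wpM2r ?ler_nat // exprn_ge0 // subr_ge0 exprn_ile1 //.
  exact: fine_ge0.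
by rewrite -lee_fin fineK ?fin_num_measure // probability_le1.
Qed.

(** * Asymptotic estimates and conclusion *)

(** [L] stands for ln n. The third condition absorbs [theta] into a power of [L], the fourth makes
    the exponent gained beat the counting cost, and the fifth brings the final bound below
    [delta]. *)
Lemma log_scale_conditions (R : realType) (theta eps delta : R) :
  0 < eps -> 0 < delta ->
  exists K : R, forall L, K <= L ->
    [/\ 1 <= L, 1 <= ln L, - ln theta <= ln L,
        3 * L ^+ 2 + 1 <= expR (eps / 4 * L) / 2 &
        delta^-1 <= expR (eps / 2 * L)].
Proof.
move=> eps0 delta0.
have k1 : 0 < expR (1 + `|ln theta|) by exact: expR_gt0.
have k2 : 0 < (16 / eps) ^+ 3 by rewrite exprn_gt0 ?divr_gt0.
have k3 : 0 < 2 / (eps * delta) by rewrite divr_gt0 ?mulr_gt0.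
(* The summands serve, in order, the first condition, the two on [ln L], the fourth and the
   fifth. *)
exists (1 + expR (1 + `|ln theta|) + (16 / eps) ^+ 3 + 2 / (eps * delta)).
move=> L KL; have L1 : 1 <= L by lra.
have L0 : 0 < L by lra.
have lnL : 1 + `|ln theta| <= ln L by rewrite -ler_expR lnK ?posrE //; lra.
have nt0 := normr_ge0 (ln theta).
have ltheta := ler_norm (- ln theta); rewrite normrN in ltheta.
split=> //; [lra|lra| |].
- have y0 : 0 <= eps / 4 * L by rewrite mulr_ge0 //; lra.
  (* The cubic term of the exponential series suffices: [L] is at least (16/eps)^3, so (eps L/4)^3
     is at least 64 L^2. *)
  have := expR_ge1Dxn 2 y0.
  have : 16 ^+ 3 <= eps ^+ 3 * L.
    have : (16 / eps) ^+ 3 <= L by lra.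
    by rewrite expr_div_n ler_pdivrMr ?exprn_gt0 // mulrC.
  move=> /(ler_wpM2r (sqr_ge0 L)) h.
  have L2 : 1 <= L ^+ 2 by rewrite exprn_ege1.
  have -> : (eps / 4 * L) ^+ 3 = (eps ^+ 3 * L * L ^+ 2) / 4 ^+ 3.
    by rewrite !exprMn exprVn; ring.
  have -> : (3`!)%:R = 6 :> R by [].
  set z := eps ^+ 3 * L * L ^+ 2 in h *.
  have : 4 ^+ 3 * L ^+ 2 <= z / 4 ^+ 3.
    rewrite ler_pdivlMr ?exprn_gt0 //; apply: le_trans h.
    rewrite le_eqVlt; apply/orP; left; apply/eqP; ring.
  lra.
- apply: (le_trans _ (expR_ge1Dx _)).
  have : 2 / (eps * delta) <= L by lra.
  rewrite invfM mulrA ler_pdivrMr // => h.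
  have : 2 / eps * eps <= L * delta * eps by rewrite ler_wpM2r // ltW.
  rewrite divfK ?gt_eqF // => h2.
  rewrite -[delta^-1]mul1r ler_pdivrMr // mulrDl.
  lra.
Qed.

(** Taking alpha = 1/(r+1) gives p >= theta (r+1)^(-q). Since 1/theta and r+1 are both at most [L],
    this is at least L^(-(1+q)). *)
Lemma block_probability_ge (R : realType) (U : probability R R)
    (theta q L : R) (r : nat) :
  0 < theta -> 0 <= q -> poly_bounded_below_at_1 U theta q ->
  r.+1%:R <= L -> - ln theta <= ln L ->
  expR (- (r.+1%:R * (1 + q) * ln L)) <=
  fine (U `](1 - r.+1%:R^-1), +oo[%classic) ^+ r.+1.
Proof.
move=> theta0 q0 Uq rL thetaL.
have r0 : 0 < r.+1%:R :> R by rewrite ltr0n.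
have := Uq r.+1%:R^-1; rewrite invr_gt0 => /(_ r0).
rewrite invf_le1 // ler1n => /(_ isT) Ur.
apply: (@le_trans _ _ ((theta * powR r.+1%:R^-1 q) ^+ r.+1)); last first.
  rewrite lerXn2r ?nnegrE ?mulr_ge0 ?powR_ge0 ?fine_ge0 ?(ltW theta0) //.
  by rewrite -lee_fin fineK ?fin_num_measure.
have -> : theta * powR r.+1%:R^-1 q = expR (ln theta - q * ln r.+1%:R).
  by rewrite /powR gt_eqF ?invr_gt0 // lnV ?posrE // mulrN expRD lnK.
rewrite -expRM_natl ler_expR -mulrA -mulrN ler_wpM2l //.
have := ler_wpM2l q0 (_ : ln r.+1%:R <= ln L).
rewrite ler_ln ?posrE // => [/(_ rL)|]; last exact: lt_le_trans rL.
lra.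
Qed.

Theorem theorem2 (R : realType) (theta eps q : R) :
  0 < theta -> 0 < eps -> eps < 1 -> 1 <= q ->
  exists c : R, 0 < c /\
  forall U : probability R R,
    supported_on_unit U -> poly_bounded_below_at_1 U theta q ->
    forall delta : R, 0 < delta ->
    exists N : nat, forall n : nat, (N <= n)%N ->
    forall r m : nat, (1 <= r)%N ->
      r%:R <= c * ln (n%:R) / ln (ln (n%:R)) ->
      (r * n)%:R + powR (n%:R) eps <= m%:R ->
      m%:R <= (r.+1 * n)%:R - powR (n%:R) eps ->
    forall (d : measure_display) (T : measurableType d) (P : probability T R)
      (X : 'I_n -> 'I_m -> {RV P >-> R}),
      iid_utilities X U ->
      (P [set w | has_envy_free_allocation (fun i j => X i j w)] < delta%:E)%E.
Proof.
move=> theta0 eps0 eps1 q1.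
(* With r+1 <= 2r, this constant gives (r+1)(1+q) ln L <= eps L/4, that is, p^(r+1) >=
   n^(-eps/4). *)
exists (eps / (8 * (1 + q))); split; first by rewrite divr_gt0 //; lra.
move=> U U01 Uq delta delta0.
have [K HK] := log_scale_conditions theta eps0 delta0.
exists (Num.truncn (expR K)).+1 => n Nn r m r1 rle mge mle d T P X iidX.
have q0 : 0 < 1 + q by lra.
have Kn : expR K <= n%:R.
  apply/ltW/(@lt_le_trans _ _ (Num.truncn (expR K)).+1%:R); last by rewrite ler_nat.
  by case/andP: (truncn_itv (expR_ge0 K)).
have n0 : 0 < n%:R :> R by apply: lt_le_trans Kn; exact: expR_gt0.
set L := ln n%:R in rle.
have nE : n%:R = expR L by rewrite lnK.
have [|L1 lnL1 thetaL large small] := HK L; first by rewrite -ler_expR -nE.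
have L0 : 0 < L by lra.
have lnL0 : 0 < ln L by lra.
have rlnL : r.+1%:R * (1 + q) * ln L <= eps / 4 * L.
  move: rle; rewrite ler_pdivlMr // => rle.
  have r2 : r.+1%:R <= 2 * r%:R :> R.
    by rewrite -natr1 mulr2n mulrDl mul1r lerD2l ler1n.
  have : r%:R * ln L * (1 + q) <= eps / (8 * (1 + q)) * L * (1 + q).
    by rewrite ler_wpM2r // ltW.
  have -> : eps / (8 * (1 + q)) * L * (1 + q) = eps / 8 * L.
    by field; rewrite gt_eqF.
  have : r.+1%:R * ((1 + q) * ln L) <= 2 * r%:R * ((1 + q) * ln L).
    by rewrite ler_wpM2r // mulr_ge0 // ltW.
  lra.
have rL : r.+1%:R <= L.
  have : r.+1%:R * 1 * 1 <= r.+1%:R * (1 + q) * ln L.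
    by rewrite !ler_pM //; lra.
  have : eps * L <= 1 * L by rewrite ler_wpM2r // ltW.
  rewrite !mulr1; lra.
have pge := block_probability_ge theta0 (le_trans ler01 q1) Uq rL thetaL.
set p := fine _ in pge.
have {}pge : expR (- (eps / 4 * L)) <= p ^+ r.+1.
  by apply: le_trans pge; rewrite ler_expR lerN2.
(* With y = n^(eps/4), the powers n^(eps/2) and n^eps become y^2 and y^4, and the remaining
   inequalities are polynomial in [y] and [L]. *)
have [y yE] : exists y, y = expR (eps / 4 * L) by eexists.
rewrite -yE in large.
have y8 : 8 <= y by nra.
have halfE : expR (eps / 2 * L) = y ^+ 2.
  by rewrite yE -expRM_natl; congr expR; field.
have fullE : powR n%:R eps = y ^+ 2 * y ^+ 2.
  by rewrite /powR gt_eqF // -halfE -expRD -/L; congr expR; field.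
rewrite halfE in small.
have y2L : L <= y ^+ 2 by nra.
(* As r+1 <= L <= y^2, at most y^2 blocks use at most y^4 = n^eps items, which is the slack of [m]
   at both ends. *)
have rsle t : t%:R <= y ^+ 2 -> (t * r.+1)%:R <= powR n%:R eps.
  by move=> ty; rewrite fullE natrM ler_pM // (le_trans rL).
pose s := Num.truncn (y ^+ 2).
have /andP[sy ys] : s%:R <= y ^+ 2 < s.+1%:R by rewrite truncn_itv // sqr_ge0.
have hS : (s * r.+1 + m <= r.+1 * n)%N.
  by rewrite -(ler_nat R) natrD; have := rsle s sy; lra.
have hD : (s * r.+1 + r * n <= m)%N.
  by rewrite -(ler_nat R) natrD; have := rsle s sy; lra.
apply: le_lt_trans (probability_envy_free_le iidX U01 hS hD) _.
rewrite -/p lte_fin.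
have mL : m%:R <= expR (2 * L).
  have -> : expR (2 * L) = n%:R * n%:R by rewrite nE -expRD; congr expR; ring.
  apply: (@le_trans _ _ (r.+1 * n)%:R).
    by apply: (le_trans mle); rewrite gerBl powR_ge0.
  rewrite natrM ler_wpM2r // (le_trans rL) // nE.
  by apply: le_trans (expR_ge1Dx _); rewrite lerDr.
have p1 : p ^+ r.+1 <= 1.
  rewrite exprn_ile1 ?fine_ge0 //.
  by rewrite -lee_fin fineK ?fin_num_measure // probability_le1.
have count_le : (n ^ s * (m ^ r.+1) ^ s)%:R <= expR ((L + 2 * L * r.+1%:R) * s%:R).
  rewrite mulrDl expRD !expRM_natr natrM !natrX -nE ler_pM ?exprn_ge0 //.
  by rewrite !lerXn2r ?nnegrE ?exprn_ge0 ?expR_ge0.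
have fail_le : (1 - p ^+ r.+1) ^+ (s * s) <= expR (- (p ^+ r.+1 * s%:R) * s%:R).
  rewrite -mulNr -mulrA -natrM expRM_natr lerXn2r ?nnegrE ?expR_ge0 ?subr_ge0 //.
  exact: expR_ge1Dx.
(* The target e^(-s) is below [delta], because 1/delta <= y^2 < s+1 <= e^s. *)
apply: (@le_lt_trans _ _ (expR (- s%:R))); last first.
  rewrite expRN -[delta]invrK ltf_pV2 ?posrE ?expR_gt0 ?invr_gt0 //.
  apply: le_lt_trans small _; apply: lt_le_trans ys _.
  by rewrite -nat1r expR_ge1Dx.
apply: (le_trans (ler_pM _ _ count_le fail_le)); rewrite ?exprn_ge0 ?subr_ge0 //.
rewrite -expRD ler_expR -mulrDl -mulN1r ler_wpM2r //.
(* Here p^(r+1) >= 1/y and s > y^2 - 1 >= y^2/2. The counting exponent per unit of [s], plus 1, is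
   at most L + 2L^2 + 1 <= y/2. *)
have : y / 2 <= p ^+ r.+1 * s%:R.
  apply: (@le_trans _ _ (y^-1 * (y ^+ 2 / 2))).
    have y0 : y != 0 by rewrite yE gt_eqF ?expR_gt0.
    by rewrite le_eqVlt; apply/orP; left; apply/eqP; field.
  rewrite ler_pM ?invr_ge0 ?divr_ge0 ?sqr_ge0 //; [lra|by rewrite yE -expRN|].
  by rewrite -nat1r in ys; nra.
have : L * r.+1%:R <= L * L by rewrite ler_wpM2l // ltW.
nra.
Qed.
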